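(* Let $\beta>0$ and $c>0$ be fixed. There exist constants $\alpha_1,\alpha_2>0$ (not depending on $n$) such that $$\pi_n\big(\hat A_1(\alpha_1,\alpha_2)\big)\to 1\quad\text{as } n\to\infty,$$ where $\hat A_1(\alpha_1,\alpha_2)$ is the set of degree sequences $\mathbf d=(d_1,\dots,d_n)$ with $\sum_{i=1}^n d_i=2E$ and $$-\sqrt{\alpha_1\log n}\;\le\; d_i-\overline d\;\le\;\sqrt{\alpha_2\log n}\qquad\text{for all } i=1,\dots,n,$$ with $\overline d=\frac1n\sum_{i=1}^n d_i$.
   Context: For each sufficiently large $n$, let $E=E_n=\lfloor \tfrac12 c\,n\log n\rfloor$ (so that the mean degree $2E/n$ is $c\log n$ up to rounding). Let $\mu_n$ be the probability measure on simple labelled graphs $G$ with vertex set $\{1,\dots,n\}$ and exactly $E$ edges given by $\mu_n(G)=\frac1Z\exp\big(-\beta\sum_{i=1}^n d_i^2\big)$, where $d_i$ is the degree of vertex $i$ in $G$ and $Z$ is the normalizing constant. Let $\pi_n$ be the law of the degree sequence $\mathbf d=(d_1,\dots,d_n)$ of a graph drawn from $\mu_n$. *)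

(* Defs.v *)
From HB Require Import structures.
From mathcomp Require Import all_boot all_order all_algebra.
From mathcomp Require Import all_classical all_reals all_analysis.
Import Order.TTheory GRing.Theory Num.Theory.
Import numFieldNormedType.Exports.

Set Implicit Arguments.
Unset Strict Implicit.
Unset Printing Implicit Defensive.

Local Open Scope classical_set_scope.
Local Open Scope ring_scope.

(* A simple labelled graph is identified with its edge set, a set of unordered
   pairs of distinct vertices; the vertex set {1, ..., n} is rendered 'I_n. *)
Definition simple_graphs (n E : nat) : {set {set {set 'I_n}}} :=
  [set G : {set {set 'I_n}} | [forall e in G, #|e| == 2%N] && (#|G| == E)]%SET.

Definition degree (n : nat) (G : {set {set 'I_n}}) (i : 'I_n) : nat :=
  #|[set e in G | i \in e]%SET|.

Definition degree_sequence (n : nat) (G : {set {set 'I_n}}) :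
    {ffun 'I_n -> nat} :=
  [ffun i => degree G i].

Definition gibbs_weight (R : realType) (beta : R) (n : nat)
    (G : {set {set 'I_n}}) : R :=
  expR (- beta * \sum_(i < n) (degree G i)%:R ^+ 2).

Definition partition_function (R : realType) (beta : R) (n E : nat) : R :=
  \sum_(G in simple_graphs n E) gibbs_weight beta G.

(* When E > 'C(n, 2) there is no graph, and [mu] is identically 0. *)
Definition mu (R : realType) (beta : R) (n E : nat) (G : {set {set 'I_n}}) : R :=
  if G \in simple_graphs n E
  then gibbs_weight beta G / partition_function beta n E else 0.

(* The image of [mu] under [degree_sequence], evaluated at the event A. *)
Definition degree_law (R : realType) (beta : R) (n E : nat)
    (A : set {ffun 'I_n -> nat}) : R :=
  \sum_(G : {set {set 'I_n}} | degree_sequence G \in A) mu beta E G.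

(* [Num.truncn] is the floor, as a natural number, of a nonnegative real. *)
Definition num_edges (R : realType) (c : R) (n : nat) : nat :=
  Num.truncn (2^-1 * c * n%:R * ln n%:R).

Definition mean_degree (R : realType) (n : nat) (d : {ffun 'I_n -> nat}) : R :=
  n%:R^-1 * \sum_(i < n) (d i)%:R.

Definition A1_hat (R : realType) (alpha1 alpha2 : R) (n E : nat) :
    set {ffun 'I_n -> nat} :=
  [set d : {ffun 'I_n -> nat} | (\sum_(i < n) d i = 2 * E)%N /\
    forall i : 'I_n,
      - Num.sqrt (alpha1 * ln n%:R) <= (d i)%:R - mean_degree R d
        <= Num.sqrt (alpha2 * ln n%:R)].

(* Main.v *)
(* Moving an edge {a, j} to {b, j} multiplies the Gibbs weight by
   exp(2 beta (d_a - d_b - 1)), and given (a, b) there are at least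
   d_a - d_b - 1 admissible vertices j. Let d be the average degree and W_i(k)
   the total weight of the graphs in which vertex i has degree k. If
   k >= d + 1 + t, move edges from i, of degree k + 1, to all the vertices l with
   d_l <= d + 1: at least sum_l (d + 1 - d_l) = n moves are available, while a
   graph is reached at most sum_l d_l = n d times, so that
   exp(2 beta t) W_i(k + 1) <= d W_i(k). Moves from high-degree vertices to i give
   the mirror inequality below d - 2 - t. With s = sqrt(alpha log n), t = s / 2
   and d = O(s^2), the ratio is at most exp(- beta s / 2); iterating it about
   s / 4 times bounds the probability of a given degree outside [d - s, d + s] by
   exp(- beta s^2 / 16), which for alpha = 48 / beta is n^-3 and survives the
   union bound over the vertex and the value of its degree. *)
Require Import Defs.
From mathcomp Require Import all_boot all_order all_algebra.
From mathcomp Require Import all_classical all_reals all_analysis.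
From mathcomp Require Import ring lra.
Import Order.TTheory GRing.Theory Num.Theory.
Import numFieldNormedType.Exports.

Local Open Scope classical_set_scope.
Local Open Scope ring_scope.

Set Implicit Arguments.
Unset Strict Implicit.
Unset Printing Implicit Defensive.

(** Sum [q * w G] over the pairs of a state [G] and a move [x] in [F G]. Each [G] has at least [lo]
    moves, which bounds the sum below. For fixed [x] the map [f x] is injective and lands in states
    of [P'] that record [x] in [B], with at most [hi] labels per state, which bounds it above. *)
Lemma double_counting (R : realType) (T X : finType) (w : T -> R)
    (P P' : pred T) (F B : T -> pred X) (f : X -> T -> T) (q lo hi : R) :
  (forall G, 0 <= w G) -> 0 <= q ->
  (forall G x, P G -> F G x ->
     [/\ P' (f x G), B (f x G) x & q * w G <= w (f x G)]) ->
  (forall x, {in [pred G | P G && F G x] &, injective (f x)}) ->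
  (forall G, P G -> lo <= #|F G|%:R) ->
  (forall G, P' G -> #|B G|%:R <= hi) ->
  q * lo * (\sum_(G | P G) w G) <= hi * \sum_(G | P' G) w G.
Proof.
move=> w0 q0 Hf finj Hlo Hhi.
have cardE (A : pred X) (y : R) : #|A|%:R * y = \sum_(x | A x) y.
  by rewrite mulr_natl -sumr_const.
apply: (@le_trans _ _ (\sum_(G | P G) \sum_(x | F G x) q * w G)).
  rewrite mulr_sumr; apply: ler_sum => G PG.
  rewrite -cardE mulrAC [leRHS]mulrC ler_wpM2l ?mulr_ge0//.
  exact: Hlo.
rewrite (exchange_big_dep xpredT)//=.
apply: (@le_trans _ _ (\sum_x \sum_(G | P' G && B G x) w G)); last first.
  rewrite mulr_sumr (exchange_big_dep P')/=; last by move=> ? ? _ /andP[].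
  apply: ler_sum => G PG; rewrite PG -cardE ler_wpM2r//.
  exact: Hhi.
apply: ler_sum => x _.
apply: (@le_trans _ _
  (\sum_(G in [set f x G | G in [pred G | P G && F G x]]%SET) w G)).
  rewrite big_imset/=; last exact: finj.
  by apply: ler_sum => G /andP[PG FG]; have [] := Hf _ _ PG FG.
rewrite [leRHS](bigID (mem [set f x G | G in [pred G | P G && F G x]]%SET))/=.
rewrite -[leLHS]addr0 lerD ?sumr_ge0//.
rewrite le_eqVlt; apply/orP; left; apply/eqP; apply: eq_bigl => G'.
apply/idP/andP => [|[]//] /imsetP[G]; rewrite inE => /andP[PG FG] ->.
have [-> -> _] := Hf _ _ PG FG; split=> //.
by apply: imset_f; rewrite inE PG.
Qed.

(** * Edge switches and their effect on degrees and weights *)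

Section Switching.
Context {n : nat}.
Implicit Types (G : {set {set 'I_n}}) (a b i j v : 'I_n).

Definition nbr G i : {set 'I_n} := [set j | [set i; j]%SET \in G]%SET.

Definition switch a b j G : {set {set 'I_n}} :=
  ([set b; j] |: (G :\ [set a; j]))%SET.

Lemma simple_card2 E G e : G \in simple_graphs n E -> e \in G -> #|e| = 2%N.
Proof. by rewrite inE => /andP[/forallP/(_ e)/implyP h _] /h/eqP. Qed.

Lemma simple_irrefl E G i : G \in simple_graphs n E -> [set i; i]%SET \notin G.
Proof.
by move=> GE; apply/negP => /(simple_card2 GE); rewrite cards2 eqxx.
Qed.

(** With loops excluded, an edge at [i] determines its other endpoint. *)
Lemma degree_nbr E G i : G \in simple_graphs n E -> degree G i = #|nbr G i|.
Proof.
move=> GE.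
have inj : {in nbr G i &, injective (fun j => [set i; j]%SET)}.
  move=> j j'; rewrite !inE => jG j'G eq_e.
  have := set22 i j; rewrite eq_e !inE => /orP[|/eqP//] /eqP ji.
  by move: jG (simple_irrefl i GE); rewrite ji => ->.
rewrite -(card_in_imset inj); apply: eq_card => e.
rewrite !inE; apply/andP/imsetP => [[eG ie]|[j]].
  have /eqP/cards2P[x [y [xy eE]]] := simple_card2 GE eG.
  move: ie eG; rewrite eE !inE => /orP[] /eqP <- eG.
    by exists y; rewrite ?inE.
  by exists x; rewrite ?inE finset.setUC.
by rewrite inE => h ->; rewrite h set21.
Qed.

Lemma degree_sum G i : degree G i = (\sum_(e in G) (i \in e))%N.
Proof.
rewrite -[RHS]big_mkcondr/= sum1_card /degree; apply: eq_card => e.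
by rewrite !inE.
Qed.

Lemma handshake E G : G \in simple_graphs n E -> (\sum_i degree G i = 2 * E)%N.
Proof.
move=> GE; under eq_bigr do rewrite degree_sum.
rewrite exchange_big/=.
rewrite (eq_bigr (fun=> 2%N)); last first.
  by move=> e eG; rewrite -big_mkcond/= sum1_card (simple_card2 GE eG).
rewrite sum_nat_const mulnC; congr muln.
by move: GE; rewrite inE => /andP[_ /eqP].
Qed.

(** For a fixed triple the reverse switch undoes the move: this is the injectivity that
    [double_counting] asks for. *)
Lemma switchK a b j G : [set a; j]%SET \in G -> [set b; j]%SET \notin G ->
  switch b a j (switch a b j G) = G.
Proof.
move=> aG bG; rewrite /switch; apply/setP => e; rewrite !inE.
case: (eqVneq e [set a; j]%SET) => [->|ea]/=; first by rewrite aG.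
by case: (eqVneq e [set b; j]%SET) => [->|//]/=; rewrite (negbTE bG).
Qed.

(** Additive on both sides to avoid truncated subtraction in [nat]. The vertex [j] loses one edge
    and gains one. *)
Lemma degree_switch a b j G v :
  a != j -> b != j -> [set a; j]%SET \in G -> [set b; j]%SET \notin G ->
  (degree (switch a b j G) v + (v == a) = degree G v + (v == b))%N.
Proof.
move=> aj bj aG bG.
have -> : degree (switch a b j G) v =
    ((v \in [set b; j]%SET) + degree (G :\ [set a; j])%SET v)%N.
  by rewrite !degree_sum /switch big_setU1//= !inE (negbTE bG) andbF.
have -> : degree G v =
    ((v \in [set a; j]%SET) + degree (G :\ [set a; j])%SET v)%N.
  by rewrite !degree_sum (big_setD1 _ aG).
rewrite !inE.
case: (eqVneq v j) => [->|_].
  by rewrite !orbT !(eq_sym j) (negbTE aj) (negbTE bj).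
by rewrite !orbF [LHS]addnC [X in (_ + X)%N = _]addnC addnA.
Qed.

Lemma switch_simple E a b j G : G \in simple_graphs n E ->
  b != j -> [set a; j]%SET \in G -> [set b; j]%SET \notin G ->
  switch a b j G \in simple_graphs n E.
Proof.
move=> GE bj aG bG; rewrite inE; apply/andP; split.
  apply/forallP => e; apply/implyP; rewrite !inE => /orP[/eqP ->|/andP[_]].
    by rewrite cards2 bj.
  by move/(simple_card2 GE) => ->.
rewrite cardsU1 !inE (negbTE bG) andbF/= add1n.
move: GE; rewrite inE (cardsD1 [set a; j]%SET G) aG => /andP[_ /eqP <-].
by rewrite add1n.
Qed.

(** With x and y the old degrees of [a] and [b], the sum of squares changes by (x - 1)^2 + (y + 1)^2
    - x^2 - y^2 = -2 (x - y - 1). *)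
Lemma gibbs_weight_switch (R : realType) (beta : R) a b j G :
  a != j -> b != j -> [set a; j]%SET \in G -> [set b; j]%SET \notin G ->
  gibbs_weight beta (switch a b j G) =
  expR (2 * beta * ((degree G a)%:R - (degree G b)%:R - 1)) *
    gibbs_weight beta G.
Proof.
move=> aj bj aG bG; rewrite /gibbs_weight -expRD; congr expR.
have ab : a != b by apply: contraNneq bG => <-.
have dv v : (degree (switch a b j G) v)%:R ^+ 2 =
    (degree G v)%:R ^+ 2 + (if v == b then 2 * (degree G b)%:R + 1 else 0) +
    (if v == a then 1 - 2 * (degree G a)%:R else 0) :> R.
  have := degree_switch v aj bj aG bG => /(congr1 (fun k => k%:R : R)).
  rewrite !natrD => /(canRL (addrK _)) ->.
  case: (eqVneq v b) => [->|_]; first by rewrite eq_sym (negbTE ab)/=; ring.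
  by case: (eqVneq v a) => [->|_]/=; ring.
under eq_bigr do rewrite dv.
rewrite !big_split/= -!big_mkcond/= !big_pred1_eq; ring.
Qed.

(** A neighbour of [a] is inadmissible only if it is [b] or a neighbour of [b]. The difference is
    taken in [R], where it may be negative. *)
Lemma switch_count (R : realType) E a b G : G \in simple_graphs n E ->
  (degree G a)%:R - (degree G b)%:R - 1 <=
  #|[pred j | [&& [set a; j]%SET \in G, [set b; j]%SET \notin G & b != j]]|%:R
  :> R.
Proof.
move=> GE; rewrite !lerBlDr natr1 -natrD ler_nat !(degree_nbr _ GE).
set S := [pred j | _].
have sub : nbr G a \subset ([set j in S] :|: (b |: nbr G b))%SET.
  apply/fintype.subsetP => j; rewrite !inE => ->/=.
  by rewrite (eq_sym j b); case: (b == j) => //=;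
    rewrite ?orbT//; case: (_ \in G).
apply: (leq_trans (subset_leq_card sub)).
apply: (leq_trans (leq_card_setU _ _)).
by rewrite cardsE addSnnS leq_add2l cardsU1 -add1n leq_add2r leq_b1.
Qed.

End Switching.

Lemma card_pred_pair (X Y : finType) (A : pred (X * Y)) :
  #|A| = (\sum_x #|[pred y | A (x, y)]|)%N.
Proof.
rewrite -sum1_card (eq_bigl (fun z => A (z.1, z.2))); last by case.
rewrite -(pair_big_dep xpredT (fun x y => A (x, y)) (fun _ _ => 1%N))/=.
by apply: eq_bigr => x _; rewrite sum1_card.
Qed.

(** * Comparison of consecutive degree levels of one vertex *)

Section LevelWeight.
Context (R : realType) (beta : R) (n E : nat).
Hypothesis beta_ge0 : 0 <= beta.
Implicit Types (G : {set {set 'I_n}}) (i j : 'I_n).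

Definition level_weight i (k : nat) : R :=
  \sum_(G in simple_graphs n E | degree G i == k) gibbs_weight beta G.

Definition avg_degree : R := (2 * E)%:R / n%:R.

Lemma gibbs_weight_ge0 G : 0 <= gibbs_weight beta G.
Proof. exact: expR_ge0. Qed.

Lemma level_weight_ge0 i k : 0 <= level_weight i k.
Proof. by apply: sumr_ge0 => G _; exact: gibbs_weight_ge0. Qed.

Lemma sum_degreeR G : G \in simple_graphs n E ->
  \sum_i (degree G i)%:R = (2 * E)%:R :> R.
Proof. by move=> GE; rewrite -(handshake GE) natr_sum. Qed.

Lemma nR_gt0 i : 0 < n%:R :> R.
Proof. by rewrite ltr0n (leq_ltn_trans _ (ltn_ord i)). Qed.

Lemma avg_degreeK i : n%:R * avg_degree = (2 * E)%:R.
Proof. by rewrite mulrC divfK// gt_eqF// (nR_gt0 i). Qed.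

Let edgeE G i : #|[pred j | [set i; j]%SET \in G]| = #|nbr G i|.
Proof. by apply: eq_card => j; rewrite !inE. Qed.

Lemma upper_step i k t : 0 <= t -> avg_degree + 1 + t <= k%:R ->
  expR (2 * beta * t) * level_weight i k.+1 <= avg_degree * level_weight i k.
Proof.
move=> t0 kt.
rewrite -(@ler_pM2l _ n%:R) ?(nR_gt0 i)// mulrA [leRHS]mulrA avg_degreeK//.
rewrite [_ * expR _]mulrC.
(* The label [(l, j)] stands for moving [{i, j}] to [{l, j}]. The reached graph contains [{l, j}],
   so the labels leading to it are among its [2 * E] ordered adjacent pairs. *)
apply: (@double_counting R _ ('I_n * 'I_n)%type (@gibbs_weight R beta n) _ _
  (fun G x => [&& (degree G x.1)%:R <= avg_degree + 1,
     [set i; x.2]%SET \in G, [set x.1; x.2]%SET \notin G & x.1 != x.2])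
  (fun G x => [set x.1; x.2]%SET \in G)
  (fun x => switch i x.1 x.2)) => //.
- exact: gibbs_weight_ge0.
- move=> G [l j]/= /andP[GE /eqP dk] /and4P[dl ij lj lNj].
  have iNj : i != j by apply: contraNneq (simple_irrefl i GE) => {2}->.
  have ilN : i != l by apply: contraNneq lj => <-.
  rewrite (switch_simple GE)//=; split.
  + have := degree_switch i iNj lNj ij lj.
    by rewrite eqxx (negbTE ilN) addn0 addn1 dk => -[->].
  + by rewrite !inE eqxx.
  + rewrite gibbs_weight_switch// ler_wpM2r ?gibbs_weight_ge0// ler_expR.
    rewrite ler_wpM2l ?mulr_ge0// dk -natr1; lra.
- move=> [l j] G G' /andP[_ /and4P[/= _ ij lj _]].
  move=> /andP[_ /and4P[/= _ ij' lj' _]].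
  by move=> eqs; rewrite -(switchK ij lj) eqs switchK.
- move=> G /andP[GE /eqP dk].
  rewrite card_pred_pair natr_sum/=.
  (* The sum runs over all [l]: those of degree above [avg_degree + 1] offer no move, but their
     terms are negative, so the termwise bound still holds. *)
  have -> : n%:R = \sum_(l < n) (avg_degree + 1 - (degree G l)%:R).
    rewrite sumrB sum_degreeR// sumr_const card_ord.
    rewrite -[X in X - _]mulr_natl mulrDr.
    by rewrite avg_degreeK// mulr1 addrAC subrr add0r.
  apply: ler_sum => l _.
  case: (leP (degree G l)%:R (avg_degree + 1)) => [dl|dl]/=; last first.
    by apply: le_trans (ler0n _ _); rewrite subr_le0 ltW.
  apply: (le_trans _ (switch_count R i l GE)).
  by rewrite dk -natr1; lra.
- move=> G /andP[GE _]; rewrite card_pred_pair -(handshake GE) ler_nat.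
  by apply: leq_sum => l _; rewrite edgeE (degree_nbr _ GE).
Qed.

Lemma lower_step i k t : 0 <= t -> k%:R + 2 + t <= avg_degree ->
  expR (2 * beta * t) * level_weight i k <= avg_degree * level_weight i k.+1.
Proof.
move=> t0 kt; have n0 := nR_gt0 i.
(* In the reached graph [j] is one of the [k.+1] neighbours of [i] while [l] is arbitrary, hence at
   most [n * k.+1] labels; then [k.+1 <= avg_degree]. *)
suff : expR (2 * beta * t) * n%:R * level_weight i k
    <= (n * k.+1)%:R * level_weight i k.+1.
  rewrite natrM mulrAC [leLHS]mulrC -[leRHS]mulrA ler_pM2l// => /le_trans.
  apply.
  by rewrite ler_wpM2r ?level_weight_ge0// -natr1; lra.
apply: (@double_counting R _ ('I_n * 'I_n)%type (@gibbs_weight R beta n) _ _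
  (fun G x => [&& avg_degree - 1 <= (degree G x.1)%:R,
     [set x.1; x.2]%SET \in G, [set i; x.2]%SET \notin G & i != x.2])
  (fun G x => [set i; x.2]%SET \in G)
  (fun x => switch x.1 i x.2)) => //.
- exact: gibbs_weight_ge0.
- move=> G [l j]/= /andP[GE /eqP dk] /and4P[dl lj ij iNj].
  have lNj : l != j by apply: contraNneq (simple_irrefl l GE) => {2}->.
  have ilN : i != l by apply: contraNneq ij => ->.
  rewrite (switch_simple GE)//=; split.
  + have := degree_switch i lNj iNj lj ij.
    by rewrite eqxx (negbTE ilN) addn0 addn1 dk => ->.
  + by rewrite !inE eqxx.
  + rewrite gibbs_weight_switch// ler_wpM2r ?gibbs_weight_ge0// ler_expR.
    by rewrite ler_wpM2l ?mulr_ge0// dk; lra.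
- move=> [l j] G G' /andP[_ /and4P[/= _ ij lj _]].
  move=> /andP[_ /and4P[/= _ ij' lj' _]].
  by move=> eqs; rewrite -(switchK ij lj) eqs switchK.
- move=> G /andP[GE /eqP dk].
  rewrite card_pred_pair natr_sum/=.
  have -> : n%:R = \sum_(l < n) ((degree G l)%:R - (avg_degree - 1)).
    rewrite sumrB sum_degreeR// sumr_const card_ord.
    rewrite -[X in _ - X]mulr_natl mulrBr.
    by rewrite avg_degreeK// mulr1 subKr.
  apply: ler_sum => l _.
  case: (leP (avg_degree - 1) (degree G l)%:R) => [dl|dl]/=; last first.
    by apply: le_trans (ler0n _ _); rewrite subr_le0 ltW.
  apply: (le_trans _ (switch_count R l i GE)).
  by rewrite dk; lra.
- move=> G /andP[GE /eqP dk]; rewrite card_pred_pair ler_nat/=.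
  by rewrite sum_nat_const card_ord edgeE -(degree_nbr _ GE) dk.
Qed.

End LevelWeight.

(** * Exponential tails of the degree of one vertex *)

Section Tails.
Context (R : realType) (beta s : R) (n E : nat).
Hypotheses (beta_ge0 : 0 <= beta) (s_ge8 : 8 <= s).
Hypothesis avg_small : avg_degree R n E <= expR (beta * s / 2).
Implicit Types (G : {set {set 'I_n}}) (i j : 'I_n).
Local Notation W := (level_weight beta E).
Local Notation avg := (avg_degree R n E).
Local Notation Z := (partition_function beta n E).

Lemma avg_degree_ge0 : 0 <= avg.
Proof. by rewrite divr_ge0. Qed.

Lemma level_weight_le i k : W i k <= Z.
Proof.
rewrite /partition_function [leRHS](bigID (fun G => degree G i == k))/=.
by rewrite lerDl sumr_ge0// => G _; exact: gibbs_weight_ge0.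
Qed.

(** Taking [t = s / 2] gains [expR (beta * s)]; by [avg_small], half of this exponent absorbs the
    factor [avg]. *)
Lemma step_ratio (x y : R) : 0 <= y ->
  expR (2 * beta * (s / 2)) * x <= avg * y -> x <= expR (- (beta * s / 2)) * y.
Proof.
move=> y0 xy; rewrite -(ler_pM2l (expR_gt0 (beta * s))) mulrA -expRD.
have -> : beta * s - beta * s / 2 = beta * s / 2 by lra.
have -> : beta * s = 2 * beta * (s / 2) by lra.
apply: (le_trans xy); rewrite ler_wpM2r//.
by apply: (le_trans avg_small); rewrite ler_expR; lra.
Qed.

Lemma upper_chain i k m : avg + 1 + s / 2 <= k%:R ->
  W i (k + m) <= expR (- (beta * s / 2)) ^+ m * W i k.
Proof.
move=> hk; elim: m => [|m IH]; first by rewrite addn0 expr0 mul1r.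
rewrite addnS exprS -mulrA.
apply: (@le_trans _ _ (expR (- (beta * s / 2)) * W i (k + m))); last first.
  by rewrite ler_wpM2l ?expR_ge0.
apply: step_ratio; first exact: level_weight_ge0.
apply: upper_step => //; first by rewrite divr_ge0// (le_trans _ s_ge8).
by apply: (le_trans hk); rewrite ler_nat leq_addr.
Qed.

(** The condition is imposed at the end [k + m] nearest to the mean, where it is strongest. The last
    step starts at [k + m - 1], so the [2] of [lower_step] becomes [1]. *)
Lemma lower_chain i k m : (k + m)%:R + 1 + s / 2 <= avg ->
  W i k <= expR (- (beta * s / 2)) ^+ m * W i (k + m).
Proof.
elim: m => [|m IH] hm; first by rewrite addn0 expr0 mul1r.
move: hm; rewrite addnS -natr1 => hm.
rewrite exprSr -mulrA.
apply: (@le_trans _ _ (expR (- (beta * s / 2)) ^+ m * W i (k + m))).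
  by apply: IH; lra.
rewrite ler_wpM2l ?exprn_ge0 ?expR_ge0//.
apply: step_ratio; first exact: level_weight_ge0.
apply: lower_step => //; last lra.
by rewrite divr_ge0// (le_trans _ s_ge8).
Qed.

(** The floor exceeds [s / 4 - 1], which is at least [s / 8] because [8 <= s]. *)
Lemma truncn_quarter :
  s / 8 <= (Num.truncn (s / 4))%:R <= s / 4.
Proof.
have s4 : 0 <= s / 4 by rewrite divr_ge0// (le_trans _ s_ge8).
have := truncn_itv s4; set m := Num.truncn _.
by rewrite -(@natr1 _ m) => /andP[-> /= h]; move: s_ge8; lra.
Qed.

(** At least [s / 8] steps, each with exponent [beta * s / 2], give [beta * s ^+ 2 / 16]. *)
Lemma chain_decay (x : R) : x <= Z ->
  expR (- (beta * s / 2)) ^+ Num.truncn (s / 4) * x <=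
  expR (- (beta * s ^+ 2 / 16)) * Z.
Proof.
move=> xZ.
have Z0 : 0 <= Z by apply: sumr_ge0 => G _; exact: gibbs_weight_ge0.
apply: (@le_trans _ _ (expR (- (beta * s / 2)) ^+ Num.truncn (s / 4) * Z)).
  by rewrite ler_wpM2l// exprn_ge0// expR_ge0.
rewrite ler_wpM2r// -expRM_natl ler_expR mulrN lerN2.
have /andP[h _] := truncn_quarter.
have bs : 0 <= beta * s / 2 by rewrite divr_ge0// mulr_ge0// (le_trans _ s_ge8).
apply: le_trans (ler_wpM2r bs h).
by rewrite le_eqVlt; apply/orP; left; apply/eqP; field.
Qed.

(** The chain begins [Num.truncn (s / 4)] levels below [k], still at distance over [3 * s / 4] from
    the mean, which exceeds the required [1 + s / 2]. *)
Lemma upper_tail i k : avg + s < k%:R ->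
  W i k <= expR (- (beta * s ^+ 2 / 16)) * Z.
Proof.
move=> hk; have /andP[_ hM] := truncn_quarter.
have a0 := avg_degree_ge0.
have Mk : (Num.truncn (s / 4) <= k)%N.
  by rewrite -(ler_nat R); move: s_ge8; lra.
rewrite -(subnK Mk); apply: le_trans (chain_decay (level_weight_le i _)).
by apply: upper_chain; rewrite natrB//; move: s_ge8; lra.
Qed.

Lemma lower_tail i k : k%:R < avg - s ->
  W i k <= expR (- (beta * s ^+ 2 / 16)) * Z.
Proof.
move=> hk; have /andP[_ hM] := truncn_quarter.
apply: le_trans (chain_decay (level_weight_le i _)).
by apply: lower_chain; rewrite natrD; move: s_ge8; lra.
Qed.

End Tails.

(** * Normalization, union bound and concentration *)

Section Union.
Context (R : realType) (beta : R) (n E : nat).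
Hypothesis graphs_neq0 : simple_graphs n E != finset.set0.
Implicit Types (G : {set {set 'I_n}}).

Lemma partition_function_gt0 : 0 < partition_function beta n E.
Proof.
have /set0Pn[G GE] := graphs_neq0.
rewrite /partition_function (bigD1 G)//= ltr_wpDr ?expR_gt0//.
by apply: sumr_ge0 => G' _; exact: gibbs_weight_ge0.
Qed.

Lemma mu_ge0 G : 0 <= mu beta E G.
Proof.
rewrite /mu; case: ifP => // _.
by rewrite divr_ge0 ?gibbs_weight_ge0// ltW// partition_function_gt0.
Qed.

Lemma sum_mu (P : pred {set {set 'I_n}}) :
  \sum_(G | P G) mu beta E G =
  (\sum_(G in simple_graphs n E | P G) gibbs_weight beta G) /
    partition_function beta n E.
Proof. by rewrite mulr_suml big_mkcondl. Qed.

Lemma sum_mu1 : \sum_(G : {set {set 'I_n}}) mu beta E G = 1.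
Proof.
rewrite (sum_mu xpredT); under eq_bigl do rewrite andbT.
by rewrite divff// gt_eqF// partition_function_gt0.
Qed.

Lemma degree_law_le1 (A : set {ffun 'I_n -> nat}) :
  degree_law beta E A <= 1 :> R.
Proof.
rewrite -sum_mu1 /degree_law.
rewrite [leRHS](bigID (fun G => degree_sequence G \in A))/=.
by rewrite lerDl sumr_ge0// => G _; exact: mu_ge0.
Qed.

Lemma degree_lawC (A : set {ffun 'I_n -> nat}) :
  1 - degree_law beta E A = \sum_(G | degree_sequence G \notin A) mu beta E G.
Proof.
rewrite -sum_mu1 /degree_law.
rewrite [X in X - _](bigID (fun G => degree_sequence G \in A))/=.
by rewrite addrAC subrr add0r.
Qed.

Lemma degree_union_bound (bad : pred nat) (delta : R)
    (A : set {ffun 'I_n -> nat}) :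
  (forall G, G \in simple_graphs n E -> degree_sequence G \notin A ->
    exists i, bad (degree G i)) ->
  (forall (i : 'I_n) k, bad k ->
    level_weight beta E i k <= delta * partition_function beta n E) ->
  0 <= delta ->
  1 - degree_law beta E A <= (n * n.+1)%:R * delta.
Proof.
move=> Abad Hdelta delta0.
rewrite degree_lawC sum_mu ler_pdivrMr ?partition_function_gt0//.
set Z := partition_function _ _ _.
(* Each graph outside [A] is charged to a vertex with a bad degree. The crude bound
   [degree G i <= n] leaves [n.+1] possible values. *)
apply: (@le_trans _ _ (\sum_(G in simple_graphs n E) \sum_(i < n)
    \sum_(k < n.+1 | bad k && (degree G i == k)) gibbs_weight beta G)).
  rewrite big_mkcondr/=; apply: ler_sum => G GE.
  have pos i :
      0 <= \sum_(k < n.+1 | bad k && (degree G i == k)) gibbs_weight beta G.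
    by apply: sumr_ge0 => k _; exact: gibbs_weight_ge0.
  case: ifPn => GA; last by apply: sumr_ge0.
  have [i bi] := Abad G GE GA.
  have dn : (degree G i < n.+1)%N.
    by rewrite (degree_nbr _ GE) ltnS -[leqRHS]card_ord max_card.
  rewrite (bigD1 i)//= (bigD1 (Ordinal dn))/= ?bi ?eqxx//.
  rewrite -addrA lerDl addr_ge0 ?sumr_ge0// => *; exact: gibbs_weight_ge0.
rewrite exchange_big/=.
have -> : (n * n.+1)%:R * delta * Z = \sum_(i < n) \sum_(k < n.+1) delta * Z.
  by rewrite !sumr_const !card_ord -mulrnA -[RHS]mulr_natl mulrA mulnC.
apply: ler_sum => i _.
rewrite (exchange_big_dep (fun k : 'I_n.+1 => bad k))/=; last first.
  by move=> ? ? _ /andP[].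
apply: (@le_trans _ _ (\sum_(k < n.+1 | bad k) delta * Z)).
  apply: ler_sum => k bk; apply: le_trans (Hdelta i k bk).
  by rewrite /level_weight; under eq_bigl do rewrite bk.
rewrite big_mkcond/=; apply: ler_sum => k _; case: ifP => // _.
by rewrite mulr_ge0// ltW// partition_function_gt0.
Qed.

End Union.

(** These graphs are the [E]-element subsets of the set of ['C(n, 2)] vertex pairs. *)
Lemma simple_graphs_neq0 n E : (E <= 'C(n, 2))%N ->
  simple_graphs n E != finset.set0.
Proof.
move=> En; rewrite -card_gt0.
have -> : simple_graphs n E =
    [set G : {set {set 'I_n}} |
      G \subset [set e : {set 'I_n} | #|e| == 2%N]%SET & #|G| == E]%SET.
  apply/finset.setP => G; rewrite !inE; congr andb.
  apply/forallP/fintype.subsetP => h e.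
    by move=> eG; rewrite inE; move/implyP: (h e); apply.
  by apply/implyP => eG; have := h e eG; rewrite inE.
by rewrite cards_draws bin_gt0 card_draws card_ord.
Qed.

Lemma concentration (R : realType) (beta alpha : R) (n E : nat) :
  0 <= beta -> (0 < n)%N -> simple_graphs n E != finset.set0 ->
  let s := Num.sqrt (alpha * ln n%:R) in
  8 <= s -> avg_degree R n E <= expR (beta * s / 2) ->
  1 - degree_law beta E (A1_hat alpha alpha (n := n) E) <=
    (n * n.+1)%:R * expR (- (beta * s ^+ 2 / 16)).
Proof.
move=> beta0 n0 GE0 s s8 avgs.
apply: (@degree_union_bound _ _ _ _ GE0 (fun k =>
  (k%:R < avg_degree R n E - s) || (avg_degree R n E + s < k%:R)));
  last exact: expR_ge0.
(* The handshake identity settles the sum condition of [A1_hat] and makes its mean the constant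
   [avg_degree], so only a degree outside the window can fail. *)
- move=> G GE; rewrite notin_setE => nA; apply: contra_notP nA.
  move=> /forallNP good; split.
    by rewrite -(handshake GE); apply: eq_bigr => i _; rewrite ffunE.
  have -> : mean_degree R (degree_sequence G) = avg_degree R n E.
    rewrite /mean_degree /avg_degree mulrC -(sum_degreeR R GE); congr (_ / _).
    by apply: eq_bigr => i _; rewrite ffunE.
  move=> i; have /negP := good i; rewrite negb_or -!leNgt -/s ffunE.
  move=> /andP[h1 h2].
  by rewrite lerBrDr lerBlDr addrC h1 addrC.
- move=> i k /orP[]; [exact: lower_tail|exact: upper_tail].
Qed.

(** * Exponential inequalities and the size of the edge number *)

Lemma sqr_le_expR (R : realType) (a b s : R) :
  0 < b -> 0 <= s -> 27 * a <= b ^+ 3 * s -> a * s ^+ 2 <= expR (b * s).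
Proof.
move=> b0 s0 h.
(* Cubing [x <= expR x] at [x = b * s / 3] produces the [27]. *)
have -> : expR (b * s) = expR (b * s / 3) ^+ 3.
  by rewrite -expRM_natl; congr expR; field.
apply: (@le_trans _ _ ((b * s / 3) ^+ 3)).
  have -> : (b * s / 3) ^+ 3 = (b ^+ 3 * s) / 27 * s ^+ 2 by field.
  by rewrite ler_wpM2r ?sqr_ge0//; lra.
rewrite lerXn2r ?nnegrE ?expR_ge0//.
  by rewrite divr_ge0// mulr_ge0// ltW.
by apply: le_trans (expR_ge1Dx _); rewrite lerDr.
Qed.

(** Squaring [1 + x / 2 <= expR (x / 2)] gives the term [x ^+ 2 / 4], which dominates [c * x]. *)
Lemma linear_le_expR (R : realType) (c x : R) :
  0 <= x -> 4 * c <= x -> 1 + c * x <= expR x.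
Proof.
move=> x0 cx.
have -> : expR x = expR (x / 2) ^+ 2.
  by rewrite -expRM_natl; congr expR; field.
apply: (@le_trans _ _ ((1 + x / 2) ^+ 2)).
  have : 4 * c * x <= x * x by rewrite ler_wpM2r.
  by rewrite expr2; lra.
rewrite lerXn2r ?nnegrE ?expR_ge0//; first by lra.
exact: expR_ge1Dx.
Qed.

Section NumEdges.
Context (R : realType) (c : R) (n : nat).
Hypotheses (c_ge0 : 0 <= c) (n_gt0 : (0 < n)%N).

Lemma ln_nat_ge0 : 0 <= ln n%:R :> R.
Proof. by rewrite ln_ge0// ler1n. Qed.

Lemma num_edges_le : (2 * num_edges c n)%:R <= c * ln n%:R * n%:R :> R.
Proof.
have h : 0 <= 2^-1 * c * n%:R * ln n%:R :> R.
  by rewrite !mulr_ge0 ?invr_ge0 ?ln_nat_ge0.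
move: h; rewrite -truncn_le -/(num_edges c n) natrM => h; lra.
Qed.

Lemma avg_num_edges_le : avg_degree R n (num_edges c n) <= c * ln n%:R.
Proof. by rewrite ler_pdivrMr ?ltr0n// num_edges_le. Qed.

(** From [1 + c * ln n <= expR (ln n) = n] follows [2 * E <= c * n * ln n <= n * (n - 1)]. *)
Lemma num_edges_bin : 4 * c <= ln n%:R -> (num_edges c n <= 'C(n, 2))%N.
Proof.
move=> cn; rewrite -(leq_pmul2l (isT : (0 < 2)%N)) -mul_bin_diag bin1.
rewrite -(ler_nat R); apply: (le_trans num_edges_le).
rewrite natrM mulrC ler_wpM2l//.
have := linear_le_expR ln_nat_ge0 cn.
rewrite lnK ?posrE ?ltr0n// -[X in _ <= X%:R]prednK// -natr1; lra.
Qed.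

End NumEdges.

Theorem theorem1 (R : realType) (beta c : R) (beta_gt0 : 0 < beta)
    (c_gt0 : 0 < c) :
  exists alpha1 alpha2 : R,
    0 < alpha1 /\ 0 < alpha2 /\
    (fun n : nat =>
       degree_law beta (num_edges c n)
         (A1_hat alpha1 alpha2 (n := n) (num_edges c n)))
      @ \oo --> (1 : R).
Proof.
pose alpha := 48 / beta.
have alpha0 : 0 < alpha by rewrite divr_gt0.
exists alpha, alpha; split => //; split => //.
pose b := beta / 2; pose a := c / alpha.
have b0 : 0 < b by rewrite divr_gt0.
have a0 : 0 < a by rewrite divr_gt0.
(* For [s >= K] the first summand gives [8 <= s], the second the hypothesis of [sqr_le_expR]. *)
pose K := 8 + 27 * a / b ^+ 3.
have K8 : 8 <= K.
  rewrite lerDl; apply: divr_ge0; last exact/exprn_ge0/ltW.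
  by apply: mulr_ge0 => //; exact: ltW.
(* Once [ln n >= L], the first summand forces [K <= s] and the second makes room for the edges. *)
pose L := K ^+ 2 / alpha + 4 * c.
(* For positive [n] the lower bound is [1 - 2 / n], since [harmonic k] is [1 / (k + 1)]. *)
apply: (@squeeze_cvgr _ _ _ _ (fun n => 1 - 2 * harmonic n.-1 : R)
  (fun=> 1)); last 2 first.
- rewrite -[X in _ --> X]subr0 -[X in _ - X](mulr0 2).
  apply: cvgB; first exact: cvg_cst.
  apply: cvgM; first exact: cvg_cst.
  rewrite -(cvg_shiftS _); exact: cvg_harmonic.
- exact: cvg_cst.
near=> n.
have n0 : (0 < n)%N by near: n; exists 1%N.
have nR0 : 0 < n%:R :> R by rewrite ltr0n.
have Ln : L <= ln n%:R.
  by rewrite -ler_expR lnK ?posrE//; near: n; exact: nbhs_infty_ger.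
have cn : 4 * c <= ln n%:R.
  by apply: le_trans Ln; rewrite lerDr divr_ge0 ?sqr_ge0// ltW.
have gr0 := simple_graphs_neq0 (num_edges_bin (ltW c_gt0) n0 cn).
rewrite (degree_law_le1 beta gr0) andbT.
pose s := Num.sqrt (alpha * ln n%:R).
have lnn0 : 0 <= ln n%:R :> R := ln_nat_ge0 R n0.
have s2 : s ^+ 2 = alpha * ln n%:R by rewrite sqr_sqrtr// mulr_ge0// ltW.
have sK : K <= s.
  rewrite -(@ler_sqr _ K s) ?nnegrE ?sqrtr_ge0 ?(le_trans _ K8)// s2.
  rewrite mulrC -ler_pdivrMr//; apply: le_trans Ln.
  by rewrite lerDl mulr_ge0// ltW.
have s8 : 8 <= s := le_trans K8 sK.
have avgs : avg_degree R n (num_edges c n) <= expR (beta * s / 2).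
  apply: (le_trans (avg_num_edges_le (ltW c_gt0) n0)).
  have -> : c * ln n%:R = a * s ^+ 2 by rewrite s2 /a; field; rewrite gt_eqF.
  have -> : beta * s / 2 = b * s by rewrite /b; field.
  apply: sqr_le_expR => //; first by rewrite (le_trans _ s8).
  rewrite [leRHS]mulrC -ler_pdivrMr ?exprn_gt0//; apply: le_trans sK.
  by rewrite lerDr.
have := concentration (ltW beta_gt0) n0 gr0 s8 avgs.
rewrite lerBlDr -lerBlDl => h; apply: le_trans h.
rewrite -/s s2 lerD2l lerN2.
have -> : - (beta * (alpha * ln n%:R) / 16) = 3%:R * - ln n%:R :> R.
  by rewrite /alpha; field; rewrite gt_eqF.
rewrite expRM_natl expRN lnK ?posrE// /harmonic/= prednK//.
rewrite natrM -natr1.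
(* The factor [1 + n%:R^-1] is at most 2, the constant in the lower bound. *)
have -> : n%:R * (n%:R + 1) * n%:R^-1 ^+ 3 = (1 + n%:R^-1) * n%:R^-1 :> R.
  by field; rewrite gt_eqF.
rewrite ler_wpM2r ?invr_ge0//.
by have : n%:R^-1 <= 1 :> R by [rewrite invf_le1// ler1n]; lra.
Unshelve. all: by end_near.
Qed.
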